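(* There is an $O(|V|+|E|)$-time algorithm that, given a graph $G=(V,E)$ and a set $W\subseteq V$, decides whether there exists a perfect edge dominating set of $G$ whose associated 3-colouring is $(B,Y,W)$ for some $B,Y$ (i.e. whose set of white vertices is exactly $W$).
   Context: Graphs are finite, simple and undirected. An edge dominates itself and every edge sharing an endpoint with it. A set $P\subseteq E(G)$ is a perfect edge dominating set if every edge of $E(G)\setminus P$ is dominated by exactly one edge of $P$. The 3-colouring $(B,Y,W)$ associated to $P$ is: $B$ the vertices incident to at least two edges of $P$ (black), $Y$ those incident to exactly one edge of $P$ (yellow), $W$ those incident to no edge of $P$ (white). *)

(* Defs.v *)
From HB Require Import structures.
From mathcomp Require Import all_boot.

Set Implicit Arguments.
Unset Strict Implicit.
Unset Printing Implicit Defensive.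

Record sgraph (T : finType) := SGraph {
  adj :> rel T;
  adj_sym : symmetric adj;
  adj_irr : irreflexive adj }.

Section PerfectEdgeDomination.
Variables (T : finType) (G : sgraph T).

Definition edges : {set {set T}} :=
  [set e | [exists u, exists v, adj G u v && (e == [set u; v])]].

(* Edges are nonempty, so this includes an edge dominating itself. *)
Definition dominates (e f : {set T}) : bool := e :&: f != set0.

Definition perfect_eds (P : {set {set T}}) : Prop :=
  P \subset edges /\
  forall f, f \in edges :\: P -> #|[set e in P | dominates e f]| = 1.

Definition degree_in (P : {set {set T}}) (v : T) : nat :=
  #|[set e in P | v \in e]|.

Definition black (P : {set {set T}}) : {set T} := [set v | 2 <= degree_in P v].
Definition yellow (P : {set {set T}}) : {set T} := [set v | degree_in P v == 1].
Definition white (P : {set {set T}}) : {set T} := [set v | degree_in P v == 0].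

Definition colouring (P : {set {set T}}) : {set T} * {set T} * {set T} :=
  (black P, yellow P, white P).

(* Adjacency-list input: |V|, |W|, the elements of W, and then, for each vertex
   in turn, its degree followed by its neighbours. The order vs, which numbers
   the vertices 0, ..., |V| - 1, and the orders of all the lists are
   arbitrary. *)
Definition encodes (W : {set T}) (x : seq nat) : Prop :=
  exists (vs ws : seq T) (nbrs : T -> seq T),
    [/\ perm_eq vs (enum T),
        perm_eq ws (enum W),
        forall v, perm_eq (nbrs v) (enum (adj G v)) &
        let num v := index v vs in
        x = size vs :: size ws :: map num ws ++
            flatten [seq size (nbrs v) :: map num (nbrs v) | v <- vs]].

End PerfectEdgeDomination.

(* A word RAM with w-bit words: registers, an initially zero memory addressed by
   words, and a read-once input stream that yields 0 once exhausted. Every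
   instruction costs one time unit. The hypothesis size x <= 2 ^ w, used with
   this machine, makes all the items of an encoding x fit in a word. *)
Inductive instr :=
| IConst of nat & nat
| IAdd of nat & nat & nat
| ISub of nat & nat & nat
| ILoad of nat & nat
| IStore of nat & nat
| IRead of nat
| IJump of nat
| IJumpZ of nat & nat
| IHalt of bool.

Definition program := seq instr.

Record config := Config {
  pc : nat;
  reg : nat -> nat;
  mem : nat -> nat;
  inp : seq nat }.

Definition init (x : seq nat) : config :=
  Config 0 (fun=> 0) (fun=> 0) x.

Definition upd (f : nat -> nat) (i a : nat) : nat -> nat :=
  fun j => if j == i then a else f j.

Definition step (w : nat) (ins : instr) (s : config) : config :=
  let: Config l r m x := s in
  match ins with
  | IConst i c => Config l.+1 (upd r i (c %% 2 ^ w)) m x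
  | IAdd i j k => Config l.+1 (upd r i ((r j + r k) %% 2 ^ w)) m x
  | ISub i j k => Config l.+1 (upd r i (r j - r k)) m x
  | ILoad i j => Config l.+1 (upd r i (m (r j))) m x
  | IStore i j => Config l.+1 r (upd m (r i) (r j)) x
  | IRead i => Config l.+1 (upd r i (head 0 x %% 2 ^ w)) m (behead x)
  | IJump l' => Config l' r m x
  | IJumpZ i l' => Config (if r i == 0 then l' else l.+1) r m x
  | IHalt _ => s
  end.

(* The answer if p halts from s within t instructions, None otherwise; jumping
   outside the program never yields an answer. *)
Fixpoint run (p : program) (w t : nat) (s : config) : option bool :=
  if t is t'.+1 then
    match onth p (pc s) with
    | Some (IHalt b) => Some b
    | Some ins => run p w t' (step w ins s)
    | None => None
    end
  else None.

(* Main.v *)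
Require Import Defs.
From HB Require Import structures.
From mathcomp Require Import all_boot zify.

Set Implicit Arguments.
Unset Strict Implicit.
Unset Printing Implicit Defensive.

(* An edge outside a perfect edge dominating set P joins a white vertex to a
   yellow one, so P consists of all the edges between non-white vertices and is
   determined by the white set W. Such a P exists iff a condition holds at every
   vertex that depends only on whether it lies in W and on its numbers of white
   and of non-white neighbours. After marking W in memory, a random access
   machine checks this condition in a single pass over the adjacency lists. *)

(** No edge of [P] meets an edge between two white vertices, and an edge from a white to a non-white
    vertex is dominated only at the latter, which must then be yellow. Every non-white vertex needs
    an edge of [P]. *)
Definition locally_ok (white_vertex : bool) (nwhite nnonwhite : nat) : bool :=
  if white_vertex then nwhite == 0
  else (0 < nnonwhite) && ((nwhite == 0) || (nnonwhite <= 1)).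

(** * White sets of perfect edge dominating sets *)

Section Characterisation.
Variables (T : finType) (G : sgraph T).
Implicit Types (W : {set T}) (P : {set {set T}}) (u v : T).

Lemma edgesP (e : {set T}) :
  reflect (exists u v, adj G u v /\ e = [set u; v]) (e \in edges G).
Proof.
rewrite inE; apply: (iffP existsP) => [[u /existsP[v /andP[uv /eqP ->]]]|].
  by exists u, v.
by case=> u [v [uv ->]]; exists u; apply/existsP; exists v; rewrite uv eqxx.
Qed.

Lemma edge_inj u v v' : v != u -> [set u; v] = [set u; v'] -> v = v'.
Proof.
move=> vu /setP/(_ v); rewrite !inE eqxx orbT (negPf vu) /=.
by move=> /esym/eqP.
Qed.

Lemma adj_neq u v : adj G u v -> v != u.
Proof. by apply: contraTneq => ->; rewrite adj_irr. Qed.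

Definition white_nbrs W v := [set u | adj G v u & u \in W].
Definition nonwhite_nbrs W v := [set u | adj G v u & u \notin W].

Definition edges_off W : {set {set T}} := [set e in edges G | [disjoint e & W]].

Lemma mem_edges_off W u v :
  adj G u v -> ([set u; v] \in edges_off W) = (u \notin W) && (v \notin W).
Proof.
move=> uv; rewrite inE; have -> /= : [set u; v] \in edges G.
  by apply/edgesP; exists u, v.
by rewrite disjoints_subset subUset !sub1set !in_setC.
Qed.

Lemma edges_off_disjoint W v e : v \in W -> e \in edges_off W -> v \notin e.
Proof. by move=> vW; rewrite inE => /andP[_ /disjointFl ->]. Qed.

Lemma edges_off_at W v :
  v \notin W -> [set e in edges_off W | v \in e] =
    (fun u => [set v; u]) @: nonwhite_nbrs W v.
Proof.
move=> vW; apply/setP => e; rewrite inE; apply/andP/imsetP.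
  move=> [eP ve]; have /edgesP[a [b [ab e_ab]]] : e \in edges G.
    by move: eP; rewrite inE => /andP[].
  move: eP ve; rewrite {}e_ab mem_edges_off // => /andP[aW bW].
  rewrite !inE => /orP[] /eqP ->; first by exists b; rewrite ?inE ?ab.
  by exists a; [rewrite inE adj_sym ab|rewrite setUC].
by case=> u; rewrite inE => /andP[vu uW] ->; rewrite mem_edges_off // !inE eqxx vW.
Qed.

Lemma degree_edges_off W v :
  degree_in (edges_off W) v = if v \in W then 0 else #|nonwhite_nbrs W v|.
Proof.
rewrite /degree_in; case: ifPn => vW.
  apply: eq_card0 => e; rewrite inE; apply/negP => /andP[eP].
  exact/negP/(edges_off_disjoint vW).
rewrite edges_off_at // card_in_imset // => u u'.
by rewrite inE => /andP[/adj_neq vu _] _; apply: edge_inj.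
Qed.

Lemma whiteP P v : reflect (exists2 e, e \in P & v \in e) (v \notin white P).
Proof.
rewrite inE cards_eq0; apply: (iffP (set0Pn _)).
  by case=> e; rewrite inE => /andP[]; exists e.
by case=> e eP ve; exists e; rewrite inE eP.
Qed.

(* An edge between two non-white vertices but outside P would be dominated by
   two different edges of P, so P is determined by its white vertices. *)
Lemma perfect_eds_edges_off P : perfect_eds G P -> P = edges_off (white P).
Proof.
move=> [sub dom]; apply/setP => e; apply/idP/idP => [eP|].
  have /edgesP[u [v [uv e_uv]]] := subsetP sub e eP.
  rewrite e_uv mem_edges_off //; apply/andP; split; apply/whiteP; exists e => //.
    by rewrite e_uv set21.
  by rewrite e_uv set22.
rewrite inE => /andP[eE]; have /edgesP[u [v [uv e_uv]]] := eE.
rewrite e_uv disjoints_subset subUset !sub1set !in_setC => /andP[/whiteP[e1 e1P ue1] /whiteP[e2 e2P ve2]].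
apply/negPn/negP => eP; have /eqP/cards1P[e0 doms] : #|[set e' in P | dominates e' e]| = 1.
  by apply: dom; rewrite inE e_uv eP -e_uv.
have e1_0 : e1 = e0.
  apply/set1P; rewrite -doms inE e1P; apply/set0Pn; exists u.
  by rewrite inE ue1 e_uv set21.
have e2_0 : e2 = e0.
  apply/set1P; rewrite -doms inE e2P; apply/set0Pn; exists v.
  by rewrite inE ve2 e_uv set22.
subst e1 e2; have /edgesP[a [b [ab e_ab]]] := subsetP sub e0 e1P.
have /negP[] := eP; suff <- : e0 = [set u; v] by [].
(* [e0] contains [u] and [v] and has at most two elements. *)
apply/eqP; rewrite eq_sym eqEcard subUset !sub1set ue1 ve2 /= e_ab !cards2.
by rewrite [u == v]eq_sym (adj_neq uv) ltnS leq_b1.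
Qed.

(** Edges of [edges_off W] avoid [u], so they can meet [[set u; v]] only in [v]. *)
Lemma dominators_edges_off W u v : u \in W ->
  #|[set e in edges_off W | dominates e [set u; v]]| = degree_in (edges_off W) v.
Proof.
move=> uW; apply: eq_card => e; rewrite [LHS]in_set [RHS]in_set.
case: (boolP (e \in _)) => //= eP.
apply/set0Pn/idP => [[z]|ve]; last by exists v; rewrite !inE ve eqxx orbT.
rewrite !inE => /andP[ze /orP[] /eqP zE]; last by rewrite -zE.
by have := edges_off_disjoint uW eP; rewrite -zE ze.
Qed.

(** An edge of [G] outside [edges_off W] has an endpoint [u] in [W]; its dominators are counted by
    the degree of the other endpoint [v], which is 0 if [v] is in [W]. *)
Lemma perfect_edges_offP W : perfect_eds G (edges_off W) <->
  (forall u v, u \in W -> adj G u v -> v \notin W /\ #|nonwhite_nbrs W v| = 1).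
Proof.
split=> [[_ dom] u v uW uv|dom].
  have := dom [set u; v]; rewrite dominators_edges_off // degree_edges_off.
  rewrite in_setD mem_edges_off // uW /=.
  have -> : [set u; v] \in edges G by apply/edgesP; exists u, v.
  by move=> /(_ isT); case: ifP.
split=> [|e]; first by apply/subsetP => e; rewrite inE => /andP[].
rewrite in_setD andbC => /andP[/edgesP[u [v [uv ->]]]].
rewrite mem_edges_off // negb_and !negbK.
wlog uW : u v uv / u \in W => [IH|_].
  case/orP=> [uW|vW]; first by apply: IH uv _ _; rewrite ?uW.
  by rewrite setUC; apply: IH; rewrite ?vW // adj_sym.
have [vW a1] := dom u v uW uv.
by rewrite dominators_edges_off // degree_edges_off (negPf vW).
Qed.

(** Vertices of [W] are always white for [edges_off W]; another vertex turns white too when all its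
    neighbours lie in [W]. *)
Lemma white_edges_offP W :
  white (edges_off W) = W <-> forall v, v \notin W -> 0 < #|nonwhite_nbrs W v|.
Proof.
split=> [/setP WE v vW|pos].
  by have := WE v; rewrite inE degree_edges_off (negPf vW) lt0n => ->.
apply/setP => v; rewrite inE degree_edges_off; case: ifPn => // /pos.
by rewrite lt0n => /negPf.
Qed.

Lemma white_eds_iff W :
  (exists P, perfect_eds G P /\ exists B Y, colouring P = (B, Y, W)) <->
  (forall v, locally_ok (v \in W) #|white_nbrs W v| #|nonwhite_nbrs W v|).
Proof.
have nbrs0 v : reflect (forall u, adj G v u -> u \notin W) (#|white_nbrs W v| == 0).
  rewrite cards_eq0; apply: (iffP eqP) => [H u vu|H].
    by move/setP/(_ u): H; rewrite !inE vu /= => ->.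
  by apply/setP => u; rewrite !inE; apply/negP => /andP[/H/negP].
split=> [[P [peds [B [Y [_ _ PW]]]]] v|ok].
  have PE := perfect_eds_edges_off peds; rewrite PW in PE.
  have /perfect_edges_offP dom : perfect_eds G (edges_off W) by rewrite -PE.
  have /white_edges_offP pos : white (edges_off W) = W by rewrite -PE.
  rewrite /locally_ok; case: ifPn => vW.
    by apply/nbrs0 => u /(dom v u vW) [].
  rewrite pos //=; apply/orP; case: (boolP (#|white_nbrs W v| == 0)); first by left.
  rewrite cards_eq0 => /set0Pn[u]; rewrite inE adj_sym => /andP[uv uW].
  by right; have [_ ->] := dom u v uW uv.
have WE : white (edges_off W) = W.
  apply/white_edges_offP => v vW.
  by have := ok v; rewrite /locally_ok (negPf vW) => /andP[].
exists (edges_off W); split; last first.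
  by exists (black (edges_off W)), (yellow (edges_off W)); rewrite /colouring WE.
apply/perfect_edges_offP => u v uW uv.
(* The condition at [u] makes [v] non-white; the condition at [v], which has the white neighbour
   [u], then leaves exactly one non-white neighbour. *)
have vW : v \notin W by move: (ok u); rewrite /locally_ok uW => /nbrs0; apply.
split=> //; move: (ok v); rewrite /locally_ok (negPf vW) => /andP[a0].
case/orP => [/nbrs0/(_ u)|a1]; first by rewrite adj_sym uv uW => /(_ isT).
by apply/eqP; rewrite eqn_leq a1.
Qed.

(* Each edge [set u; v] has at most the two orientations (u, v) and (v, u). *)
Lemma sum_degrees_le : \sum_v #|adj G v| <= 2 * #|edges G|.
Proof.
under eq_bigr do rewrite -sum1_card.
rewrite pair_big_dep /= mulnC -sum_nat_const.
rewrite (partition_big (fun p : T * T => [set p.1; p.2]) (mem (edges G))) /=; last first.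
  by move=> [u v] uv; apply/edgesP; exists u, v.
apply: leq_sum => e /edgesP[u [v [uv ->]]]; rewrite sum1dep_card.
apply: (@leq_trans #|[set (u, v); (v, u)]|); last by rewrite cards2 ltnS leq_b1.
apply: subset_leq_card; apply/subsetP => -[a b]; rewrite !inE !xpair_eqE /=.
case/andP=> ab /eqP abE; have := set21 a b; rewrite abE !inE.
case/orP=> /eqP aE; subst a; rewrite eqxx /=.
  by rewrite (edge_inj (adj_neq ab) abE) eqxx.
by rewrite [RHS]setUC in abE; rewrite (edge_inj (adj_neq ab) abE) eqxx orbT.
Qed.

End Characterisation.

(* r0: vertices left, r1: items left in the current list, r2: current vertex,
   r3: last item read, r4: scratch, r5: the constant 1, r6 and r7: non-white and
   white neighbours seen so far; mem u = 1 marks the white vertices u. *)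
Definition white_eds_prog : program :=
  [:: IConst 5 1; IRead 0; IRead 1;
      (*  3 *) IJumpZ 1 8; IRead 3; IStore 3 5; ISub 1 1 5; IJump 3;
      (*  8 *) IJumpZ 0 32; IRead 1; IConst 6 0; IConst 7 0;
      (* 12 *) IJumpZ 1 20; IRead 3; ILoad 4 3; IAdd 7 7 4; ISub 4 5 4; IAdd 6 6 4;
               ISub 1 1 5; IJump 12;
      (* 20 *) ILoad 4 2; IJumpZ 4 24; IJumpZ 7 29; IHalt false;
      (* 24 *) IJumpZ 6 23; IJumpZ 7 29; ISub 4 6 5; IJumpZ 4 29; IHalt false;
      (* 29 *) IAdd 2 2 5; ISub 0 0 5; IJump 8;
      (* 32 *) IHalt true].

(** * Correctness and running time of the program *)

Section Execution.
Variable w : nat.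
Local Notation exec := (run white_eds_prog w).

(* With run blocked for /=, rewriting with runS executes a single instruction;
   letting /= run past an undecided conditional jump would branch over all
   instructions at each step. *)
Lemma runS p t s : run p w t.+1 s =
  match onth p (pc s) with
  | Some (IHalt b) => Some b
  | Some ins => run p w t (step w ins s)
  | None => None
  end.
Proof. by []. Qed.

(** Allows execution paths of different lengths to share one time bound. *)
Lemma run_le p t t' s b : run p w t s = Some b -> t <= t' -> run p w t' s = Some b.
Proof.
elim: t t' s => [|t IH] [|t'] s //=.
by case: (onth p (pc s)) => // -[] * //; apply: IH.
Qed.

Local Arguments run : simpl never.

(** Each item costs 5 instructions and the exit test 1. The fuel [t] left over is arbitrary, so that
    the lemmas on the loops chain. *)
Lemma exec_marks (ws : seq nat) r (m : nat -> nat) x t :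
  r 1 = size ws -> r 5 = 1 -> all (gtn (2 ^ w)) ws ->
  exists r' (m' : nat -> nat), [/\ r' 0 = r 0, r' 2 = r 2, r' 5 = 1,
    forall u : nat, m' u = (if u \in ws then 1 else m u) &
    exec (5 * size ws + 1 + t) (Config 3 r m (ws ++ x)) = exec t (Config 8 r' m' x)].
Proof.
elim: ws r m => [|u ws IH] r m r1 r5.
  move=> _; exists r, m; split=> //.
  by rewrite (_ : _ + _ + t = t.+1) // runS /= r1.
rewrite [all _ _]/= => /andP[uw ws_w].
have [] := IH (upd (upd r 3 u) 1 (size ws)) (upd m u 1) => //.
move=> r' [m' [r'0 r'2 r'5 m'E E]].
exists r', m'; split=> //.
  by move=> v; rewrite m'E /upd inE; case: eqP; case: ifP.
rewrite (_ : 5 * size (u :: ws) + 1 + t = (5 * size ws + 1 + t).+4.+1); last by rewrite /=; lia.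
rewrite runS /= r1 /=; do 4!rewrite runS /=.
by rewrite /upd /= r5 r1 /= subn1 modn_small.
Qed.

Lemma exec_neighbours (white : pred nat) l r (m : nat -> nat) x t :
  r 1 = size l -> r 5 = 1 -> (forall u, m u = white u) ->
  all (gtn (2 ^ w)) l -> r 6 + r 7 + size l < 2 ^ w ->
  exists r', [/\ r' 0 = r 0, r' 2 = r 2, r' 5 = 1,
    r' 6 = r 6 + count (predC white) l /\ r' 7 = r 7 + count white l &
    exec (8 * size l + 1 + t) (Config 12 r m (l ++ x)) = exec t (Config 20 r' m x)].
Proof.
move=> + + mE; elim: l r => [|u l IH] r r1 r5.
  move=> _ _; exists r; split=> //; first by rewrite /= !addn0.
  by rewrite (_ : _ + _ + t = t.+1) // runS /= r1.
rewrite [all _ _]/= => /andP[uw l_w] r67.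
(* The registers after one iteration, which needs no branching: the mark is added to r7 and 1 minus
   the mark to r6. The bound on r6 + r7 prevents wrap-around. *)
set r3 := upd (upd (upd (upd (upd (upd r 3 u) 4 (white u)) 7 (r 7 + white u))
  4 (~~ white u)) 6 (r 6 + ~~ white u)) 1 (size l).
have [||||r' [r'0 r'2 r'5 [r'6 r'7] E]] := IH r3 => //.
  by move: r67; rewrite /r3 /upd /=; case: (white u); lia.
exists r'; split=> //; first by rewrite r'6 r'7 /r3 /upd /= !addnA.
rewrite (_ : 8 * size (u :: l) + 1 + t = (8 * size l + 1 + t).+4.+4); last by rewrite /=; lia.
rewrite -E runS /= r1 /=; do 7!rewrite runS /=.
rewrite /upd /= r5 r1 /= subn1 (modn_small uw) mE.
have -> : 1 - white u = ~~ white u by case: (white u).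
rewrite modn_small; last by move: r67 => /=; case: (white u); lia.
rewrite modn_small; last by move: r67 => /=; case: (white u); lia.
by [].
Qed.

(** The longest path from 20 back to 8 takes 9 instructions; on shorter ones more fuel [t']
    remains. *)
Lemma exec_check (white : pred nat) r (m : nat -> nat) x t :
  r 2 + 1 < 2 ^ w -> r 5 = 1 -> (forall u, m u = white u) ->
  if locally_ok (white (r 2)) (r 7) (r 6) then
    exists r' t', [/\ t <= t', r' 0 = (r 0).-1, r' 2 = (r 2).+1, r' 5 = 1 &
       exec (9 + t) (Config 20 r m x) = exec t' (Config 8 r' m x)]
  else exec (9 + t) (Config 20 r m x) = Some false.
Proof.
move=> r2w r5 mE.
have next r1 t1 : t <= t1 -> r1 0 = r 0 -> r1 2 = r 2 -> r1 5 = 1 ->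
    exists r' t', [/\ t <= t', r' 0 = (r 0).-1, r' 2 = (r 2).+1, r' 5 = 1 &
      exec t1.+3 (Config 29 r1 m x) = exec t' (Config 8 r' m x)].
  move=> tt1 r10 r12 r15; do 3!rewrite runS /=; do 2!eexists; split; last by [].
  - exact: tt1.
  - by rewrite /upd /= r10 r15 subn1.
  - by rewrite /upd /= r12 r15 modn_small // addn1.
  - exact: r15.
rewrite /locally_ok addnC.
do 2!rewrite addnS runS /=; rewrite {1}/upd /= mE; case: (white (r 2)) => /=.
  rewrite addnS runS /=; rewrite {1}/upd /=; case: eqP => _ /=.
    by do 3!rewrite addnS; apply: next; rewrite ?leq_addr.
  by rewrite addnS runS.
rewrite addnS runS /=; rewrite {1}/upd /= lt0n; case: (r 6 =P 0) => [_|a0] /=.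
  by rewrite addnS runS.
rewrite addnS runS /=; rewrite {1}/upd /=; case: (r 7 =P 0) => [_|b0] /=.
  by do 3!rewrite addnS; apply: next; rewrite ?leq_addr.
(* By truncated subtraction, r6 - 1 is zero iff r6 is at most 1. *)
do 2!rewrite addnS runS /=; rewrite {1 2}/upd /= /upd /= r5 subn_eq0.
case: leqP => _ /=; first by do 3!rewrite addnS; apply: next; rewrite ?leq_addr.
by rewrite addnS runS.
Qed.

Fixpoint check_all (white : pred nat) i (ls : seq (seq nat)) : bool :=
  if ls is l :: ls' then
    locally_ok (white i) (count white l) (count (predC white) l) &&
    check_all white i.+1 ls'
  else true.

(** A list costs 4 instructions of set-up, [8 * size l + 1] for its loop and at most 9 for the
    check; the final 2 are the exit jump and the halt. *)
Lemma exec_vertices (white : pred nat) ls r (m : nat -> nat) t :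
  r 0 = size ls -> r 5 = 1 -> (forall u, m u = white u) ->
  r 2 + size ls < 2 ^ w ->
  all (fun l => (size l < 2 ^ w) && all (gtn (2 ^ w)) l) ls ->
  exec (sumn [seq 8 * size l + 14 | l <- ls] + 2 + t)
    (Config 8 r m (flatten [seq size l :: l | l <- ls])) =
  Some (check_all white (r 2) ls).
Proof.
move=> + + mE; elim: ls r t => [|l ls IH] r t r0 r5 r2w.
  by move=> _; rewrite add0n addnC addnS runS /= r0 /= addnS runS.
rewrite [all _ _]/= => /andP[/andP[lw l_w] ls_w].
rewrite [check_all _ _ _]/= [flatten _]/=.
set x := flatten _; set k := sumn _ in IH.
rewrite (_ : _ + _ + t = (8 * size l + 1 + (9 + (k + 2 + t))).+4); last first.
  by rewrite /= -/k; lia.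
rewrite runS /= r0 /=; do 3!rewrite runS /=.
rewrite (modn_small lw) mod0n; set r1 := upd _ 7 0.
have [||//|||r' [r'0 r'2 r'5 [r'6 r'7] ->]] := @exec_neighbours white l r1 m x (9 + (k + 2 + t)) => //.
have := @exec_check white r' m x (k + 2 + t).
rewrite r'0 r'2 r'6 r'7 /r1 /upd /= !add0n => /(_ _ r'5 mE).
have r2w' : r 2 + 1 < 2 ^ w by move: r2w => /=; lia.
move=> /(_ r2w'); case: ifP => //= _ [r2 [t' [tt' r20 r22 r25 ->]]].
rewrite -r22; apply: (@run_le _ (k + 2 + t)) => //; apply: IH => //.
  by rewrite r20 r0.
by rewrite r22; move: r2w => /=; lia.
Qed.

Lemma size_flatten_lists (ls : seq (seq nat)) :
  size ls <= size (flatten [seq size l :: l | l <- ls]).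
Proof. by elim: ls => //= l ls IH; rewrite size_cat; lia. Qed.

Lemma exec_white_eds (ws : seq nat) ls x t :
  x = size ls :: size ws :: ws ++ flatten [seq size l :: l | l <- ls] ->
  size x <= 2 ^ w -> all (gtn (size ls)) ws ->
  all (fun l => (size l <= size ls) && all (gtn (size ls)) l) ls ->
  exec (6 + 5 * size ws + sumn [seq 8 * size l + 14 | l <- ls] + t) (init x) =
  Some (check_all [in ws] 0 ls).
Proof.
move=> xE x_w ws_n ls_n; set S := sumn _; set x' := flatten _ in xE.
(* Each list contributes at least its length entry to [x], and the two header entries make both
   bounds strict. *)
have [kw nw] : size ws < 2 ^ w /\ size ls < 2 ^ w.
  have := size_flatten_lists ls; move: x_w; rewrite xE /= size_cat -/x'; lia.
(* Ensures that [IConst 5 1] really stores 1. *)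
have w1 : 1 < 2 ^ w by move: x_w; rewrite xE /=; apply: leq_trans.
have small l : all (gtn (size ls)) l -> all (gtn (2 ^ w)) l.
  by apply: sub_all => u /= /ltn_trans; apply.
rewrite (_ : 6 + _ + _ + t = (5 * size ws + 1 + (S + 2 + t)).+3); last by lia.
rewrite /init xE; do 3!rewrite runS /=.
rewrite !modn_small //; set r := upd _ 1 _.
have [//|//||r' [m' [r'0 r'2 r'5 m'E ->]]] := @exec_marks ws r (fun=> 0) x' (S + 2 + t).
  exact: small.
rewrite /S /x' (@exec_vertices [in ws]) ?r'2 ?r'0 //.
by apply: sub_all ls_n => l /andP[ln /small ->]; rewrite andbT (leq_ltn_trans ln).
Qed.

End Execution.

(** * Adjacency lists and vertex numbering *)

Section Encoding.
Variables (T : finType) (G : sgraph T) (W : {set T}).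
Variables (vs ws : seq T) (nbrs : T -> seq T).
Hypotheses (vsE : perm_eq vs (enum T)) (wsE : perm_eq ws (enum W))
  (nbrsE : forall v, perm_eq (nbrs v) (enum (adj G v))).
Let num v := index v vs.

Let mem_vs v : v \in vs.
Proof. by rewrite (perm_mem vsE) mem_enum. Qed.

Lemma size_vs : size vs = #|T|.
Proof. by rewrite (perm_size vsE) -cardT. Qed.

Lemma num_lt v : num v < size vs.
Proof. by rewrite index_mem. Qed.

Lemma num_inj : injective num.
Proof. by move=> u v E; rewrite -(nth_index u (mem_vs u)) -/(num u) E nth_index. Qed.

Lemma white_num v : (num v \in map num ws) = (v \in W).
Proof. by rewrite mem_map ?(perm_mem wsE) ?mem_enum //; apply: num_inj. Qed.

Lemma size_nbrs v : size (nbrs v) = #|adj G v|.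
Proof. by rewrite (perm_size (nbrsE v)) -cardE. Qed.

Lemma count_nbrs (p : pred nat) (q : pred T) v : (forall u, p (num u) = q u) ->
  count p (map num (nbrs v)) = #|[set u | adj G v u & q u]|.
Proof.
move=> pq; have s_uniq : uniq (nbrs v) by rewrite (perm_uniq (nbrsE v)) enum_uniq.
rewrite count_map -size_filter -(card_uniqP (filter_uniq _ s_uniq)) cardsE.
by apply: eq_card => u; rewrite mem_filter /= pq (perm_mem (nbrsE v)) mem_enum andbC.
Qed.

Lemma check_all_nbrs :
  check_all [in map num ws] 0 [seq map num (nbrs v) | v <- vs] <->
  (forall v, locally_ok (v \in W) #|white_nbrs G W v| #|nonwhite_nbrs G W v|).
Proof.
pose ok v := locally_ok (v \in W) #|white_nbrs G W v| #|nonwhite_nbrs G W v|.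
suff -> : check_all [in map num ws] 0 [seq map num (nbrs v) | v <- vs] = all ok vs.
  by split=> [/allP H v|H]; [apply: H|apply/allP => v _; apply: H].
have vs_uniq : uniq vs by rewrite (perm_uniq vsE) enum_uniq.
(* Generalised to a suffix of [vs], whose first vertex has the length of the prefix as its number
   because [vs] is duplicate-free. *)
suff H : forall s pre, vs = pre ++ s ->
    check_all [in map num ws] (size pre) [seq map num (nbrs v) | v <- s] = all ok s.
  exact: (H vs [::]).
elim=> //= v s IH pre vsD; rewrite -(size_rcons pre v) IH ?cat_rcons //.
have <- : num v = size pre.
  rewrite /num vsD index_cat /= eqxx addn0; case: ifP => // v_pre.
  by move: vs_uniq; rewrite vsD cat_uniq /= v_pre andbF.
rewrite white_num (count_nbrs (q := [in W])) ?(count_nbrs (q := [predC W])) //.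
  by move=> u; rewrite /= white_num.
by move=> u; rewrite /= white_num.
Qed.

Lemma check_time_le :
  sumn [seq 8 * size l + 14 | l <- [seq map num (nbrs v) | v <- vs]] <=
  16 * #|edges G| + 14 * #|T|.
Proof.
rewrite -map_comp sumnE big_map (perm_big _ vsE) big_enum /=.
under eq_bigr do rewrite size_map size_nbrs.
rewrite big_split /= -big_distrr /= sum_nat_const (mulnC 14) leq_add2r.
by rewrite -[16]/(8 * 2) -mulnA leq_mul2l sum_degrees_le.
Qed.

End Encoding.

Theorem theorem17 :
  exists (p : program) (c : nat),
  forall (T : finType) (G : sgraph T) (W : {set T}) (x : seq nat) (w : nat),
    encodes G W x -> size x <= 2 ^ w ->
    exists b : bool,
      run p w (c * (#|T| + #|edges G| + 1)) (init x) = Some b /\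
      (b <-> exists P : {set {set T}},
               perfect_eds G P /\
               exists B Y : {set T}, colouring P = (B, Y, W)).
Proof.
(* 19 = 5 + 14: marking and checking costs per vertex. It also exceeds the 16 per edge and the
   constant 6. *)
exists white_eds_prog, 19 => T G W x w [vs [ws [nbrs [vsE wsE nbrsE xE]]]] x_w.
pose num v := index v vs; pose ls := [seq map num (nbrs v) | v <- vs].
exists (check_all [in map num ws] 0 ls); split; last first.
  by rewrite (check_all_nbrs vsE wsE nbrsE); apply: iff_sym; apply: white_eds_iff.
have num_l s : all (gtn (size ls)) (map num s).
  by apply/allP => _ /mapP[v _ ->]; rewrite /= size_map (num_lt vsE).
apply: (run_le (t := 6 + 5 * size (map num ws) +
  sumn [seq 8 * size l + 14 | l <- ls] + 0)).
  apply: exec_white_eds => //.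
    rewrite xE /ls size_map size_map -map_comp; congr [:: _, _ & _ ++ flatten _].
    by apply: eq_map => v /=; rewrite size_map.
  apply/allP => _ /mapP[v _ ->]; rewrite num_l andbT !size_map.
  by rewrite (size_nbrs nbrsE) (size_vs vsE) max_card.
have time_le k S n m : k <= n -> S <= 16 * m + 14 * n ->
  6 + 5 * k + S + 0 <= 19 * (n + m + 1) by lia.
rewrite size_map; apply: time_le (check_time_le vsE nbrsE).
by rewrite (perm_size wsE) -cardE max_card.
Qed.
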